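(* Let $\xi$ be a (homogeneous) vector field on $R=k[[\mathbf y]][\mathbf y^{-1}]\otimes\Lambda(\mathbf x)$, and let its adjoint operator $\xi^*$ be defined by $$\langle\xi^*(f),g\rangle=-(-1)^{|\xi||f|}\langle f,\xi(g)\rangle,\qquad f,g\in R.$$ Then $\xi^*(f)=\xi(f)+\nabla(\xi)f$ for all $f\in R$.
   Context: $k$ is a field of characteristic zero. Let $y^1,\dots,y^m$ be variables of even integer degree and $x^1,\dots,x^n$ variables of odd integer degree. Put $k[[\mathbf y]][\mathbf y^{-1}]:=k[[y^1,\dots,y^m]][(y^1)^{-1},\dots,(y^m)^{-1}]$ (in the graded sense), let $\Lambda(\mathbf x)=\Lambda(x^1,\dots,x^n)$ be the exterior algebra, and let $R=k[[\mathbf y]][\mathbf y^{-1}]\otimes\Lambda(\mathbf x)$, a graded commutative algebra. The formal integral $\int:R\to k$ is the tensor product of the residue on $k[[\mathbf y]][\mathbf y^{-1}]$ (the coefficient at $(y^1)^{-1}\cdots(y^m)^{-1}$) and the Berezin integral on $\Lambda(\mathbf x)$ (the coefficient at the top monomial $x^1\cdots x^n$, i.e. the product of the traces on $\Lambda(x^i)$ with $x^i\mapsto1$, $1\mapsto0$). It defines the nondegenerate invariant pairing $\langle f,g\rangle=\int fg$ on $R$. A vector field on $R$ is a derivation of the form $\xi=\sum_i f_i\frac{\partial}{\partial z_i}$, where $z_i$ runs over the variables $y^1,\dots,y^m,x^1,\dots,x^n$ and $f_i\in R$; its degree is $|\xi|=|f_i|-|z_i|$. Its divergence is $\nabla(\xi)=\sum_i(-1)^{|f_i||z_i|}\frac{\partial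 f_i}{\partial z_i}$, an element of degree $|\xi|$. *)

(* Defs.v *)
From HB Require Import structures.
From mathcomp Require Import all_boot all_order all_algebra.
From mathcomp Require Import finmap.
From mathcomp Require Import mathcomp_extra boolp classical_sets functions.
From mathcomp Require Import cardinality fsbigop.
From mathcomp Require Import zify ring.

Set Implicit Arguments.
Unset Strict Implicit.
Unset Printing Implicit Defensive.

Import Order.TTheory GRing.Theory Num.Theory.
Local Open Scope ring_scope.

(* lia does not see through the dependent type of finfun application. *)
Local Ltac flia :=
  repeat match goal with
  | |- context [@fun_of_fin _ _ _ ?f ?i] =>
      let x := fresh "x" in move: (f i) => x
  end; lia.

Notation expo m := {ffun 'I_m -> int}.

Definition ydeg m (dy : 'I_m -> int) (a : expo m) : int :=
  \sum_(i < m) a i * dy i.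

Definition bounded_by (k : fieldType) m (N : nat) (f : expo m -> k) : Prop :=
  forall a, f a != 0 -> forall i, - N%:Z <= a i.

Definition degrees_in (k : fieldType) m (dy : 'I_m -> int) (s : seq int)
    (f : expo m -> k) : Prop :=
  forall a, f a != 0 -> ydeg dy a \in s.

(* Coefficient families of the elements of k[[y]][y^-1]: [bounded_by N f] says
   that (y^1 ... y^m)^N f is a power series, and [degrees_in dy s f] that only
   finitely many degrees occur.  The latter is the graded sense of the
   completion: a homogeneous component may be an infinite series, but an element
   is a finite sum of homogeneous components. *)
Definition is_laurent (k : fieldType) m (dy : 'I_m -> int)
    (f : expo m -> k) : Prop :=
  (exists N, bounded_by N f) /\ (exists s, degrees_in dy s f).

Definition laurent_pred (k : fieldType) m (dy : 'I_m -> int) :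
  {pred (expo m -> k^o)} := fun f => `[< is_laurent dy f >].

Section LaurentModule.
Variables (k : fieldType) (m : nat) (dy : 'I_m -> int).

Fact laurent_pred_closed : submod_closed (@laurent_pred k m dy).
Proof.
split=> [|c f g /asboolP[[N fN] [s fs]] /asboolP[[M gM] [t gt]]]; apply/asboolP.
  by split; [exists 0 | exists [::]] => a; rewrite eqxx.
have nz a : (c *: f + g) a != 0 -> f a != 0 \/ g a != 0.
  move=> h; have [fa0|] := eqVneq (f a) 0; last by left.
  right; apply: contraNneq h => ga0.
  by change (c * f a + g a == 0); rewrite fa0 ga0 mulr0 addr0.
split.
  exists (N + M)%N => a /nz[/fN h|/gM h] i; have := h i; flia.
by exists (s ++ t) => a /nz[/fs h|/gt h]; rewrite mem_cat h ?orbT.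
Qed.

HB.instance Definition _ := GRing.isSubmodClosed.Build k (expo m -> k^o)
  (@laurent_pred k m dy) laurent_pred_closed.

Record laurent := Laurent
  { lcoef :> expo m -> k^o; laurentP : lcoef \in @laurent_pred k m dy }.

HB.instance Definition _ := [isSub for lcoef].
HB.instance Definition _ := [Choice of laurent by <:].
HB.instance Definition _ := [SubChoice_isSubLmodule of laurent by <:].

End LaurentModule.
Arguments laurent k {m} dy.

Section LaurentTheory.
Variables (k : fieldType) (m : nat) (dy : 'I_m -> int).
Implicit Types (f g h : laurent k dy) (a b c : expo m).

Lemma laurent_eq f g : f =1 g -> f = g.
Proof. by move=> fg; apply: val_inj; apply: funext. Qed.

Lemma laurentD f g a : (f + g) a = f a + g a. Proof. by []. Qed.
Lemma laurentZ (c : k) f a : (c *: f) a = c * f a. Proof. by []. Qed.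
Lemma laurent0 a : (0 : laurent k dy) a = 0. Proof. by []. Qed.

Lemma laurent_bound f : exists N, bounded_by N f.
Proof. by have /asboolP[] := laurentP f. Qed.

Lemma laurent_degrees f : exists s, degrees_in dy s f.
Proof. by have /asboolP[] := laurentP f. Qed.

Lemma ydegD a b : ydeg dy (a + b) = ydeg dy a + ydeg dy b.
Proof. by rewrite -big_split; apply: eq_bigr => i _; rewrite ffunE mulrDl. Qed.

Lemma ydeg0 : ydeg dy 0 = 0.
Proof. by rewrite /ydeg big1 // => i _; rewrite ffunE mul0r. Qed.

Definition box_expo (K : nat) (e : {ffun 'I_m -> 'I_(K + K).+1}) : expo m :=
  [ffun i => (e i)%:Z - K%:Z].

Definition box (K : nat) : {fset expo m} :=
  [fset box_expo e | e in {: {ffun 'I_m -> 'I_(K + K).+1}}]%fset.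

Lemma boxP (K : nat) a : (forall i, - K%:Z <= a i <= K%:Z) -> a \in box K.
Proof.
move=> aK; apply/imfsetP; exists [ffun i => inord (absz (a i + K%:Z))] => //=.
by apply/ffunP => i; rewrite /box_expo !ffunE inordK; have := aK i; flia.
Qed.

Lemma in_box (K : nat) a i : a \in box K -> - K%:Z <= a i <= K%:Z.
Proof.
by move=> /imfsetP[e _ ->]; rewrite /box_expo ffunE; have := ltn_ord (e i); flia.
Qed.

Lemma expo_ub a : exists K : nat, forall i, a i <= K%:Z.
Proof.
exists (\sum_(i < m) absz (a i))%N => i.
by rewrite (bigD1 i) //=; flia.
Qed.

(* The sum has finite support for all Laurent f and g, see [lmul_fun_box]. *)
Definition lmul_fun f g c : k := \sum_(a \in [set: expo m]) (f a * g (c - a)).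

Lemma lmul_fun_box f g N M K c : bounded_by N f -> bounded_by M g ->
  (N <= K)%N -> (forall i, c i + M%:Z <= K%:Z) ->
  lmul_fun f g c = \sum_(a <- box K) f a * g (c - a).
Proof.
move=> fN gM NK cK; apply: fsbigTE => a; apply: contraNeq.
rewrite mulf_eq0 negb_or => /andP[/fN fa /gM ga]; apply: boxP => i.
by have := fa i; have := ga i; have := cK i; rewrite !ffunE; flia.
Qed.

Lemma lmul_fun_neq0 f g c : lmul_fun f g c != 0 ->
  exists a, f a != 0 /\ g (c - a) != 0.
Proof.
move=> fg0; apply: contrapT => /forallNP nfg; move/negP: fg0; apply.
apply/eqP; apply: fsbig1 => a _; apply/eqP; rewrite mulf_eq0.
by have /not_andP[/negP|/negP] := nfg a; rewrite negbK => ->; rewrite ?orbT.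
Qed.

Fact lmul_subproof f g : lmul_fun f g \in @laurent_pred k m dy.
Proof.
have [[N fN] [M gM]] := (laurent_bound f, laurent_bound g).
have [[s fs] [t gt]] := (laurent_degrees f, laurent_degrees g).
apply/asboolP; split.
  exists (N + M)%N => c /lmul_fun_neq0[a [/fN fa /gM ga]] i.
  by have := fa i; have := ga i; rewrite !ffunE; flia.
exists [seq x + y | x <- s, y <- t] => c /lmul_fun_neq0[a [/fs fa /gt ga]].
apply/allpairsP; exists (ydeg dy a, ydeg dy (c - a)); split=> //=.
by rewrite -ydegD addrC subrK.
Qed.

Definition lmul f g : laurent k dy := Laurent (lmul_subproof f g).

Definition lone_fun a : k := (a == 0)%:R.

Fact lone_subproof : lone_fun \in @laurent_pred k m dy.
Proof.
have nz a : lone_fun a != 0 -> a = 0.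
  by rewrite /lone_fun; case: (eqVneq a 0) => //; rewrite eqxx.
apply/asboolP; split.
  by exists 0 => a /nz-> i; rewrite ffunE.
by exists [:: 0] => a /nz->; rewrite ydeg0 inE.
Qed.

Definition lone : laurent k dy := Laurent lone_subproof.

Fact lmulC : commutative lmul.
Proof.
move=> f g; apply: laurent_eq => c.
rewrite /= /lmul_fun (@reindex_fsbigT _ _ _ _ _ (fun a => c - a)).
  by apply: eq_fsbigr => a _; rewrite subKr mulrC.
by exists (fun a => c - a) => a; rewrite subKr.
Qed.

Fact lmulA : associative lmul.
Proof.
move=> f g h; apply: laurent_eq => c.
have [[N fN] [M gM] [P hP]] :=
  And3 (laurent_bound f) (laurent_bound g) (laurent_bound h).
have [C cC] := expo_ub c.
have lb : bounded_by (N + M)%N (lmul f g).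
  move=> d /lmul_fun_neq0[a [/fN fa /gM ga]] i.
  by have := fa i; have := ga i; rewrite !ffunE; flia.
have lb' : bounded_by (M + P)%N (lmul g h).
  move=> d /lmul_fun_neq0[a [/gM fa /hP ga]] i.
  by have := fa i; have := ga i; rewrite !ffunE; flia.
pose K := (N + M + C + P)%N.
rewrite [LHS](lmul_fun_box (K := (K + M)%N) fN lb'); first last.
- by move=> i; have := cC i; flia.
- flia.
rewrite [RHS](lmul_fun_box (K := K) lb hP); first last.
- by move=> i; have := cC i; flia.
- flia.
transitivity
  (\sum_(d <- box K) \sum_(a <- box (K + M)) f a * g (d - a) * h (c - d)).
  rewrite exchange_big /=; apply: eq_bigr => a _.
  have [->|/fN fa] := eqVneq (f a) 0.
    by rewrite mul0r big1 // => d _; rewrite !mul0r.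
  under eq_bigr do rewrite -mulrA.
  rewrite -mulr_sumr; congr (_ * _).
  rewrite /lmul_fun (@reindex_fsbigT _ _ _ _ _ (fun d => d - a)); last first.
    by exists (fun b => b + a) => b; rewrite ?subrK ?addrK.
  have E d : c - a - (d - a) = c - d by rewrite opprB addrA subrK.
  under eq_fsbigr do rewrite E.
  apply: fsbigTE => d; apply: contraNeq.
  rewrite mulf_eq0 negb_or => /andP[/gM ga /hP ha]; apply: boxP => i.
  by have := fa i; have := ga i; have := ha i; have := cC i; rewrite !ffunE; flia.
rewrite big_seq [RHS]big_seq; apply: eq_bigr => d dK.
rewrite -mulr_suml /= (lmul_fun_box (K := (K + M)%N) fN gM) //; first flia.
by move=> i; have := in_box i dK; flia.
Qed.

Fact lmul1 : left_id lone lmul.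
Proof.
move=> f; apply: laurent_eq => c; rewrite /= /lmul_fun.
rewrite (fsbigTE [fset 0]%fset) ?big_seq_fset1 /= /lone_fun.
  by rewrite eqxx mul1r subr0.
by move=> a; rewrite inE /= => /negPf->; rewrite mul0r.
Qed.

Fact lmulDl : left_distributive lmul +%R.
Proof.
move=> f g h; apply: laurent_eq => c.
have [[N fN] [M gM] [P hP]] :=
  And3 (laurent_bound f) (laurent_bound g) (laurent_bound h).
have [C cC] := expo_ub c.
have lb : bounded_by (N + M)%N (f + g).
  move=> a; rewrite laurentD => fga i.
  have [fa|/fN/(_ i)] := eqVneq (f a) 0; last flia.
  by move: fga; rewrite fa add0r => /gM/(_ i); flia.
pose K := (N + M + C + P)%N.
have cK i : c i + P%:Z <= K%:Z by have := cC i; flia.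
rewrite laurentD /= (lmul_fun_box (K := K) lb hP) //; last flia.
rewrite (lmul_fun_box (K := K) fN hP) //; last flia.
rewrite (lmul_fun_box (K := K) gM hP) //; last flia.
by rewrite -big_split; apply: eq_bigr => a _; rewrite laurentD mulrDl.
Qed.

Fact lone_neq0 : lone != 0.
Proof.
apply/eqP => /(congr1 (fun f : laurent k dy => f 0)) /=.
by rewrite /lone_fun eqxx => /eqP; rewrite oner_eq0.
Qed.

HB.instance Definition _ :=
  GRing.Zmodule_isComNzRing.Build (laurent k dy)
    lmulA lmulC lmul1 lmulDl lone_neq0.

Definition lderiv_fun (i : 'I_m) f a : k :=
  (a i + 1)%:~R * f (a + [ffun j => (j == i)%:Z]).

Fact lderiv_subproof i f : lderiv_fun i f \in @laurent_pred k m dy.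
Proof.
have [[N fN] [s fs]] := (laurent_bound f, laurent_degrees f).
have nz a : lderiv_fun i f a != 0 -> f (a + [ffun j => (j == i)%:Z]) != 0.
  by apply: contraNneq; rewrite /lderiv_fun => ->; rewrite mulr0.
apply/asboolP; split.
  exists N.+1 => a /nz/fN fa j.
  by have := fa j; rewrite !ffunE; case: (j == i); flia.
exists [seq x - ydeg dy [ffun j => (j == i)%:Z] | x <- s] => a /nz/fs fa.
apply/mapP; exists (ydeg dy (a + [ffun j => (j == i)%:Z])) => //.
by rewrite ydegD addrK.
Qed.

Definition lderiv i f : laurent k dy := Laurent (lderiv_subproof i f).

End LaurentTheory.

(* Unshadow the finset names overridden by classical_sets. *)
From mathcomp Require Import fintype finset.

(* L (x) Lambda(x^1, ..., x^n): the coordinate of f at S is the coefficient of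
   the monomial x^S, the product of the x^j for j in S taken in increasing
   order. *)
Definition extalg (L : Type) (n : nat) := {ffun {set 'I_n} -> L}.

Definition inversions n (S T : {set 'I_n}) : nat :=
  #|[set p : 'I_n * 'I_n | [&& p.1 \in S, p.2 \in T & (p.2 < p.1)%N]]|.

HB.instance Definition _ (L : zmodType) n := GRing.Zmodule.on (extalg L n).
HB.instance Definition _ (k : pzRingType) (L : lmodType k) n :=
  GRing.Lmodule.on (extalg L n).

Section ExtAlg.
Variables (L : comNzRingType) (n : nat).
Implicit Types (f g h : extalg L n) (S T U : {set 'I_n}).

(* x^S x^T = (-1)^(inversions S T) x^(S u T) for disjoint S and T, 0 otherwise;
   the elements of L have even degree, hence commute with the x^j. *)
Definition emul f g : extalg L n :=
  [ffun U : {set 'I_n} => \sum_(S : {set 'I_n} | S \subset U)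
     (-1) ^+ inversions S (U :\: S) * (f S * g (U :\: S))].

Definition eone : extalg L n := [ffun S : {set 'I_n} => (S == set0)%:R].

Lemma inversionsUl S1 S2 T : [disjoint S1 & S2] ->
  inversions (S1 :|: S2) T = (inversions S1 T + inversions S2 T)%N.
Proof.
move=> dS; rewrite /inversions -cardsUI [X in (_ + X)%N](_ : _ = 0%N).
  by rewrite addn0; apply: eq_card => p; rewrite !inE andb_orl.
apply/eqP; rewrite cards_eq0; apply/eqP/setP => p; rewrite !inE.
apply/negP => /andP[/and3P[p1 _ _] /and3P[p2 _ _]].
by move/pred0P: dS => /(_ p.1) /=; rewrite p1 p2.
Qed.

Lemma inversionsUr S T1 T2 : [disjoint T1 & T2] ->
  inversions S (T1 :|: T2) = (inversions S T1 + inversions S T2)%N.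
Proof.
move=> dT; rewrite /inversions -cardsUI [X in (_ + X)%N](_ : _ = 0%N).
  by rewrite addn0; apply: eq_card => p; rewrite !inE andb_orl andb_orr.
apply/eqP; rewrite cards_eq0; apply/eqP/setP => p; rewrite !inE.
apply/negP => /andP[/and3P[_ p1 _] /and3P[_ p2 _]].
by move/pred0P: dT => /(_ p.2) /=; rewrite p1 p2.
Qed.

Lemma inversions0l T : inversions set0 T = 0%N.
Proof. by apply/eqP; rewrite cards_eq0; apply/eqP/setP => p; rewrite !inE. Qed.

Lemma inversions0r S : inversions S set0 = 0%N.
Proof.
by apply/eqP; rewrite cards_eq0; apply/eqP/setP => p; rewrite !inE andbF.
Qed.

Fact emulA : associative emul.
Proof.
move=> f g h; apply/ffunP => U; rewrite !ffunE.
transitivity (\sum_(S : {set 'I_n} | S \subset U)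
    \sum_(V : {set 'I_n} | (V \subset U) && (S \subset V))
      (-1) ^+ (inversions S (U :\: S) + inversions (V :\: S) (U :\: V)) *
      (f S * g (V :\: S) * h (U :\: V))).
  apply: eq_bigr => S SU; rewrite ffunE !mulr_sumr.
  rewrite (reindex_onto (fun V => V :\: S) (fun T => T :|: S)) /=; last first.
    move=> T; rewrite subsetD => /andP[_ dTS].
    by rewrite setDUl setDv setU0; apply/setDidPl.
  apply: eq_big => [V|V /andP[_ /eqP <-]].
    have -> : (V :\: S :|: S == V) = (S \subset V).
      by rewrite setUC; apply/eqP/idP => [<-|/setUidPr E]; 
         [exact: subsetUl | rewrite setDE setUIr setUCr setIT].
    apply/andP/andP => -[A B]; split=> //.
      move: A; rewrite subsetD => /andP[A _]; apply/subsetP => x xV.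
      have [xS|xS] := boolP (x \in S); first exact: (subsetP SU).
      by apply: (subsetP A); rewrite !inE xS.
    exact: setSD.
  have -> : (U :\: S) :\: ((V :\: S :|: S) :\: S) = U :\: (V :\: S :|: S).
    apply/setP => x; rewrite !inE.
    by case: (x \in S); case: (x \in U); case: (x \in V).
  rewrite exprD; ring.
rewrite (exchange_big_dep (fun V : {set 'I_n} => V \subset U)) /=; last first.
  by move=> S V _ /andP[].
apply: eq_bigr => V VU; rewrite ffunE mulr_suml mulr_sumr.
apply: eq_big => [S|S /andP[SU /andP[_ SV]]].
  rewrite VU /=; apply/andP/idP => [[]//|SV]; split=> //.
  exact: subset_trans VU.
have UE : U :\: S = (V :\: S) :|: (U :\: V).
  apply/setP => x; rewrite !inE.
  have := subsetP VU x; have := subsetP SV x.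
  by case: (x \in S); case: (x \in V); case: (x \in U) => // A B;
     try (by have := A isT); try (by have := B isT).
have VE : inversions V (U :\: V) =
    (inversions S (U :\: V) + inversions (V :\: S) (U :\: V))%N.
  rewrite -inversionsUl; last first.
    rewrite -setI_eq0; apply/eqP/setP => x; rewrite !inE.
    by case: (x \in S).
  congr inversions; apply/setP => x; rewrite !inE.
  by have := subsetP SV x; case: (x \in S) => //= ->.
have UVE : inversions S (U :\: S) =
    (inversions S (V :\: S) + inversions S (U :\: V))%N.
  rewrite UE inversionsUr // -setI_eq0; apply/eqP/setP => x; rewrite !inE.
  by case: (x \in V); rewrite ?andbF.
rewrite VE UVE !exprD; ring.
Qed.

Fact emul1l : left_id eone emul.
Proof.
move=> f; apply/ffunP => U; rewrite ffunE (bigD1 set0) ?sub0set //=.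
rewrite big1 => [|S /andP[_ /negPf S0]]; last by rewrite !ffunE S0 mul0r mulr0.
by rewrite addr0 setD0 inversions0l !ffunE eqxx !mul1r.
Qed.

Fact emul1r : right_id eone emul.
Proof.
move=> f; apply/ffunP => U; rewrite ffunE (bigD1 U) //=.
rewrite big1 => [|S /andP[SU SneU]].
  by rewrite addr0 setDv inversions0r !ffunE eqxx mul1r mulr1.
rewrite !ffunE; have /negPf-> : U :\: S != set0.
  by apply: contraNneq SneU => /eqP; rewrite setD_eq0 => US; rewrite eqEsubset SU.
by rewrite !mulr0.
Qed.

Fact emulDl : left_distributive emul +%R.
Proof.
move=> f g h; apply/ffunP => U; rewrite !ffunE -big_split /=.
by apply: eq_bigr => S _; rewrite ffunE mulrDl mulrDr.
Qed.

Fact emulDr : right_distributive emul +%R.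
Proof.
move=> f g h; apply/ffunP => U; rewrite !ffunE -big_split /=.
by apply: eq_bigr => S _; rewrite ffunE !mulrDr.
Qed.

Fact eone_neq0 : eone != 0.
Proof.
by apply/eqP => /ffunP/(_ set0)/eqP; rewrite !ffunE eqxx oner_eq0.
Qed.

HB.instance Definition _ := GRing.Zmodule_isNzRing.Build (extalg L n)
  emulA emul1l emul1r emulDl emulDr eone_neq0.

(* Left derivative: moving x^j to the front of x^(j |: S) costs one sign for
   each element of S below j. *)
Definition ederiv (j : 'I_n) f : extalg L n :=
  [ffun S : {set 'I_n} => if j \in S then 0
     else (-1) ^+ #|[set s in S | (s < j)%N]| * f (j |: S)].

End ExtAlg.

Section VectorFields.
Variables (k : fieldType) (m n : nat).
Variables (dy : 'I_m -> int) (dx : 'I_n -> int).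

Definition Ralg := extalg (laurent k dy) n.

(* Zero is homogeneous of every degree. *)
Definition homog (d : int) (f : Ralg) : Prop :=
  forall (S : {set 'I_n}) (a : expo m),
    f S a != 0 -> ydeg dy a + \sum_(j in S) dx j = d.

Definition zdeg (z : 'I_m + 'I_n) : int :=
  match z with inl i => dy i | inr j => dx j end.

Definition partial (z : 'I_m + 'I_n) (f : Ralg) : Ralg :=
  match z with
  | inl i => [ffun S : {set 'I_n} => lderiv i (f S)]
  | inr j => ederiv j f
  end.

Definition residue (f : laurent k dy) : k := f [ffun=> -1].

Definition berezin (f : Ralg) : laurent k dy := f [set: 'I_n].

Definition integral (f : Ralg) : k := residue (berezin f).

Definition pairing (f g : Ralg) : k := integral (f * g).

(* sum_z (vcoef z) d/dz, with |vcoef z| = d + |z|. *)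
Record vfield (d : int) := VField
  { vcoef : 'I_m + 'I_n -> Ralg;
    vcoefP : forall z, homog (d + zdeg z) (vcoef z) }.

Definition vapp d (xi : vfield d) (f : Ralg) : Ralg :=
  \sum_z vcoef xi z * partial z f.

Definition divergence d (xi : vfield d) : Ralg :=
  \sum_z (-1 : k) ^ ((d + zdeg z) * zdeg z) *: partial z (vcoef xi z).

(* The sign (-1)^(|xi||f|) only makes sense for homogeneous f; linearity determines the
   operator on all of Ralg. *)
Definition is_adjoint d (xi : vfield d) (T : {linear Ralg -> Ralg}) : Prop :=
  forall (p : int) (f g : Ralg), homog p f ->
    pairing (T f) g = - ((-1) ^ (d * p) * pairing f (vapp xi g)).

End VectorFields.

(* Main.v *)
Require Import Defs.
From HB Require Import structures.
From mathcomp Require Import all_boot all_order all_algebra.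
From mathcomp Require Import finmap boolp classical_sets fsbigop.
From mathcomp Require Import zify ring.
From mathcomp Require Import fintype finset.
Import GRing.Theory.
Local Open Scope ring_scope.

Set Implicit Arguments.
Unset Strict Implicit.
Unset Printing Implicit Defensive.

(** The formula is integration by parts.  Write xi = sum_z v_z d/dz and
    T f = xi(f) + div(xi) f.  For f homogeneous, applying the signed Leibniz
    rule twice (once for v_z times f g, once for f times g) and commuting f
    past v_z gives

      T f * g + (-1)^(|xi||f|) f * xi(g) = sum_z +- d/dz (v_z f g),

    which is [adjoint_total_derivative].  The right-hand side has integral zero:
    d/dy^i y^a = a_i y^(a - e_i) never produces the exponent -1 in y^i, and
    d/dx^j never produces a monomial containing x^j ([integral_partial]).  So T
    is an adjoint of xi ([adjointP]).

    An adjoint is unique.  The pairing is nondegenerate, because multiplying by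
    the monomial complementary to y^a x^S moves the coefficient of y^a x^S to
    the residue of the top component ([pairing_nondegenerate]).  Hence the
    defining identity, which is about homogeneous f, determines T on homogeneous
    elements; it then determines T by linearity, since every element is a finite
    sum of homogeneous ones ([homog_decomposition]).  The finiteness is where
    the graded nature of the completion enters.

    All signs depend on parities only.  As the y^i are even and the x^j odd, a
    homogeneous f involves only monomials x^S with the size of S of one parity,
    and the Leibniz and commutation rules are proved under this weaker
    assumption ([has_parity]). *)

(** * Laurent series *)

Section Laurent.
Variables (k : fieldType) (m : nat) (dy : 'I_m -> int).
Implicit Types (f g : laurent k dy) (a b c : expo m).

Lemma lmulE f g c : (f * g) c = lmul_fun f g c. Proof. by []. Qed.

Lemma laurentN f a : (- f) a = - f a. Proof. by []. Qed.

Lemma laurent_sum (I : Type) (r : seq I) (P : pred I) (F : I -> laurent k dy) a :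
  (\sum_(i <- r | P i) F i) a = \sum_(i <- r | P i) F i a.
Proof. by elim/big_ind2: _ => // x1 x2 y1 y2 <- <-. Qed.

Fact lmono_subproof b :
  (fun a => (a == b)%:R : k) \in @laurent_pred k m dy.
Proof.
have nz a : (a == b)%:R != 0 :> k -> a = b by case: (eqVneq a b) => //; rewrite eqxx.
have [K bK] := expo_ub (- b).
apply/asboolP; split; last by exists [:: ydeg dy b] => a /nz->; rewrite inE.
by exists K => a /nz-> i; have := bK i; rewrite ffunE; move: (b i) => x; lia.
Qed.

(** The monomial y^b. *)
Definition lmono b : laurent k dy := Laurent (lmono_subproof b).

Lemma lmonoM b f c : (lmono b * f) c = f (c - b).
Proof.
rewrite lmulE /lmul_fun (fsbigTE [fset b]%fset) ?big_seq_fset1 /= ?eqxx ?mul1r //.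
by move=> a; rewrite in_fset1 /= => /negPf->; rewrite mul0r.
Qed.

(** Scalars act through multiplication by constants, so that compatibility of
    scaling with products follows from associativity. *)
Lemma laurent_scale1M (t : k) f : ((t *: (1 : laurent k dy) : laurent k dy) * f) = t *: f.
Proof.
apply: laurent_eq => c; rewrite lmulE /lmul_fun laurentZ.
have t1 a : (t *: (1 : laurent k dy)) a = t * (a == 0)%:R by [].
rewrite (fsbigTE [fset (0 : expo m)]%fset) ?big_seq_fset1.
  by rewrite t1 eqxx mulr1 subr0.
by move=> a; rewrite in_fset1 t1 => /negPf->; rewrite mulr0 mul0r.
Qed.

Lemma laurent_scalerAl (t : k) f g : t *: (f * g) = (t *: f) * g.
Proof. by rewrite -laurent_scale1M mulrA laurent_scale1M. Qed.

Lemma laurent_scalerAr (t : k) f g : t *: (f * g) = f * (t *: g).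
Proof. by rewrite mulrC laurent_scalerAl mulrC. Qed.

Lemma expoD a b i : (a + b) i = a i + b i. Proof. exact: ffunE. Qed.

Lemma expoB a b i : (a - b) i = a i - b i. Proof. by rewrite !ffunE. Qed.

(** Coefficientwise, c_i + 1 = a_i + (c_i + 1 - a_i) distributes the exponent
    over the two factors.  All three convolutions are first rewritten as sums
    over one box K of exponents that contains their supports, where sums may be
    added termwise. *)
Lemma lderivM i f g : lderiv i (f * g) = lderiv i f * g + f * lderiv i g.
Proof.
apply: laurent_eq => c; rewrite laurentD !lmulE /= /lderiv_fun lmulE.
have [[N fN] [M gM]] := (laurent_bound f, laurent_bound g).
have [C cC] := expo_ub c.
set e : expo m := [ffun j => _].
have eb j : 0 <= e j <= 1 by rewrite ffunE; case: (j == i).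
have ei : e i = 1 by rewrite ffunE eqxx.
pose K := (N + M + C + 2)%N.
have f'N : bounded_by N.+1 (lderiv i f).
  move=> a; rewrite /= /lderiv_fun -/e => h j.
  have /fN/(_ j) : f (a + e) != 0 by apply: contraNneq h => ->; rewrite mulr0.
  by have := eb j; rewrite expoD; move: (a j) (e j) => x y; lia.
have g'M : bounded_by M.+1 (lderiv i g).
  move=> a; rewrite /= /lderiv_fun -/e => h j.
  have /gM/(_ j) : g (a + e) != 0 by apply: contraNneq h => ->; rewrite mulr0.
  by have := eb j; rewrite expoD; move: (a j) (e j) => x y; lia.
rewrite (lmul_fun_box (K := K) fN gM); first last.
- by move=> j; have := cC j; have := eb j; rewrite expoD; move: (c j) (e j) => x y; lia.
- lia.
rewrite [X in _ = _ + X](lmul_fun_box (K := K) fN g'M); first last.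
- by move=> j; have := cC j; have := eb j; move: (c j) (e j) => x y; lia.
- lia.
have -> : lmul_fun (lderiv i f) g c
   = \sum_(a <- box m K) ((a i)%:~R * f a) * g (c + e - a).
  (* The derivative of f shifts exponents by e; undoing the shift lines its
     terms up with those of the other two sums. *)
  rewrite /lmul_fun (@reindex_fsbigT _ _ _ _ _ (fun a => a - e)); last first.
    by exists (fun a => a + e) => a; rewrite ?subrK ?addrK.
  have E a : lderiv i f (a - e) * g (c - (a - e)) =
             ((a i)%:~R * f a) * g (c + e - a).
    by rewrite /= /lderiv_fun -/e subrK expoB ei subrK opprB addrA.
  under eq_fsbigr do rewrite E.
  apply: fsbigTE => a; apply: contraNeq.
  rewrite !mulf_eq0 !negb_or => /andP[/andP[_ /fN fa] /gM ga]; apply: boxP => j.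
  have := fa j; have := ga j; have := cC j; have := eb j; rewrite expoB expoD /K.
  by move: (c j) (a j) (e j) => x y z; lia.
rewrite mulr_sumr -big_split /=; apply: eq_bigr => a _.
rewrite /lderiv_fun -/e.
have -> : c - a + e = c + e - a by rewrite addrAC.
rewrite expoB.
by rewrite !intrD mulrNz; ring.
Qed.

Lemma lderiv_linear i (t : k) f g :
  lderiv i (t *: f + g) = t *: lderiv i f + lderiv i g.
Proof.
apply: laurent_eq => a; rewrite laurentD laurentZ /= /lderiv_fun laurentD laurentZ.
ring.
Qed.

(** The coefficient of the derivative at y^a carries the factor a_i + 1, which
    vanishes at a_i = -1. *)
Lemma residue_lderiv i f : residue (lderiv i f) = 0.
Proof. by rewrite /residue /= /lderiv_fun ffunE addNr mul0r. Qed.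

Fact ltrunc_subproof (P : pred int) f :
  (fun a => if P (ydeg dy a) then f a else 0) \in @laurent_pred k m dy.
Proof.
have [[N fN] [s fs]] := (laurent_bound f, laurent_degrees f).
apply/asboolP; split; [exists N => a | exists s => a]; case: ifP => _; rewrite ?eqxx //.
  exact: fN.
exact: fs.
Qed.

Definition ltrunc (P : pred int) f : laurent k dy :=
  Laurent (ltrunc_subproof P f).

End Laurent.

(** * Exterior algebras *)

(** A subset of U with j adjoined is either a subset S of U or j |: S: this is
    how the terms of a product are sorted according to which factor carries
    x^j. *)
Lemma big_subset_setU1 (T : finType) (V : nmodType) (j : T) (U : {set T})
    (F : {set T} -> V) : j \notin U ->
  \sum_(S : {set T} | S \subset j |: U) F S =
  \sum_(S : {set T} | S \subset U) (F S + F (j |: S)).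
Proof.
move=> jU; rewrite big_split /= (bigID (fun S : {set T} => j \in S)) /= addrC; congr (_ + _).
  apply: eq_bigl => S; have [jS|jS] := boolP (j \in S); rewrite /= ?andbF ?andbT.
    by apply/esym/negbTE; apply: contra jU => /subsetP; apply.
  by rewrite -{2}(setU1K jU) subsetD1 jS andbT.
rewrite (reindex_onto (fun S : {set T} => j |: S) (fun S => S :\ j)) /=; last first.
  by move=> S /andP[_ jS]; rewrite setD1K.
apply: eq_bigl => S; rewrite setU11 andbT.
have [jS|jS] := boolP (j \in S).
  rewrite [in RHS](_ : S \subset U = false); last first.
    by apply/negbTE; apply: contra jU => /subsetP; apply.
  by rewrite andbC; apply: contraTF jS => /andP[/eqP <- _]; rewrite !inE eqxx.
rewrite setU1K // eqxx andbT -{2}(setU1K jU) subsetD1 jS andbT.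
by rewrite subUset sub1set setU11.
Qed.

Section Exterior.
Variables (L : comNzRingType) (n : nat).
Implicit Types (f g : extalg L n) (S T U : {set 'I_n}).

(** The zero element has both parities. *)
Definition has_parity (b : bool) f := forall S, f S != 0 -> odd #|S| = b.

Lemma emulE f g U : (f * g) U =
  \sum_(S : {set 'I_n} | S \subset U)
     (-1) ^+ inversions S (U :\: S) * (f S * g (U :\: S)).
Proof. exact: ffunE. Qed.

Lemma esignE (b : bool) f S : ((-1) ^+ b * f) S = (-1) ^+ b * f S.
Proof. by rewrite !mulr_sign; case: b; rewrite ?ffunE. Qed.

(** Each pair in S x T is an inversion of exactly one of (S, T) and (T, S). *)
Lemma inversionsC S T : [disjoint S & T] ->
  (inversions S T + inversions T S = #|S| * #|T|)%N.
Proof.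
move=> /pred0P dST; rewrite -cardsX.
have -> : inversions T S =
    #|[set p : 'I_n * 'I_n | [&& p.1 \in S, p.2 \in T & (p.1 < p.2)%N]]|.
  rewrite /inversions -(card_imset _ (f := fun p : 'I_n * 'I_n => (p.2, p.1))).
    apply: eq_card => -[x y]; rewrite inE /=; apply/imsetP/and3P.
      by case=> -[u v]; rewrite inE => /and3P[/= ? ? ?] [-> ->].
    by case=> xS yT xy; exists (y, x); rewrite ?inE /= ?xS ?yT.
  by move=> [? ?] [? ?] [-> ->].
rewrite /inversions -cardsUI [X in (_ + X)%N](_ : _ = 0%N) ?addn0.
  apply: eq_card => -[x y]; rewrite !inE /= -!andb_orr.
  case xS: (x \in S) => //=; case yT: (y \in T) => //=.
  rewrite -neq_ltn; apply: contraTneq xS => /val_inj yx.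
  by have := dST x; rewrite /= -yx yT andbT => ->.
apply/eqP; rewrite cards_eq0; apply/eqP/setP => p; rewrite !inE.
by apply/negP => /andP[/and3P[_ _ +] /and3P[_ _]]; lia.
Qed.

(** Exchanging S and its complement in U matches the terms of f g with those of
    g f; by [inversionsC] the signs differ by the parity of the product of the
    two sizes. *)
Lemma emulC_parity b c f g : has_parity b f -> has_parity c g ->
  f * g = (-1) ^+ (b && c) * (g * f).
Proof.
move=> fb gc; apply/ffunP => U; rewrite esignE !emulE mulr_sumr.
rewrite [RHS](reindex_onto (fun S => U :\: S) (fun S => U :\: S)) /=; last first.
  by move=> S /setIidPr SU; rewrite setDDr setDv set0U.
apply: eq_big => [S|S SU].
  rewrite subsetDl /= setDDr setDv set0U.
  by apply/idP/eqP => [/setIidPr|/setIidPr].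
have -> : U :\: (U :\: S) = S by rewrite setDDr setDv set0U; apply/setIidPr.
have [->|fS] := eqVneq (f S) 0; first by rewrite !(mul0r, mulr0).
have [->|gS] := eqVneq (g (U :\: S)) 0; first by rewrite !(mul0r, mulr0).
have dS : [disjoint S & U :\: S].
  by rewrite -setI_eq0; apply/eqP/setP => x; rewrite !inE; case: (x \in S).
rewrite -(fb _ fS) -(gc _ gS) -oddM -inversionsC // signr_odd exprD.
rewrite mulrA -(mulrA _ _ (_ ^+ _)) -expr2 sqrr_sign mulr1.
by rewrite [f S * _]mulrC.
Qed.

Lemma card_lt_disjoint (j : 'I_n) S T : [disjoint S & T] ->
  #|[set s in S :|: T | (s < j)%N]| =
  (#|[set s in S | (s < j)%N]| + #|[set s in T | (s < j)%N]|)%N.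
Proof.
move=> /pred0P dST; rewrite -cardsUI [X in (_ + X)%N](_ : _ = 0%N) ?addn0.
  by apply: eq_card => x; rewrite !inE andb_orl.
apply/eqP; rewrite cards_eq0; apply/eqP/setP => x; rewrite !inE.
by have := dST x; rewrite /=; case: (x \in S) => //= ->; rewrite andbF.
Qed.

Lemma inversions1l (j : 'I_n) T :
  inversions [set j] T = #|[set s in T | (s < j)%N]|.
Proof.
rewrite /inversions -(card_imset _ (f := fun s : 'I_n => (j, s))); last by move=> x y [].
apply: eq_card => -[x y]; rewrite !inE /=; apply/and3P/imsetP.
  by case=> /eqP-> yT yj; exists y; rewrite ?inE ?yT.
by case=> s; rewrite inE => /andP[sT sj] [-> ->].
Qed.

(** The inversions of T with the singleton count the elements of T above j. *)
Lemma inversions1r (j : 'I_n) T : j \notin T ->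
  (#|[set s in T | (s < j)%N]| + inversions T [set j])%N = #|T|.
Proof.
move=> jT; rewrite -inversions1l addnC inversionsC ?cards1 ?muln1 //.
by rewrite disjoint_sym disjoints1.
Qed.

(** Moving x^j to the front of x^S x^T costs one sign per element of S below j
    if it comes from x^S.  If it comes from x^T it must also cross all of x^S,
    which gives the sign (-1)^b. *)
Lemma ederivM j b f g : has_parity b f ->
  ederiv j (f * g) = ederiv j f * g + (-1) ^+ b * (f * ederiv j g).
Proof.
move=> fb; apply/ffunP => V.
rewrite [RHS]ffunE esignE !emulE [LHS]ffunE mulr_sumr -big_split /= emulE.
have nin S U : j \notin U -> S \subset U -> j \notin S.
  by move=> jU SU; apply: contra jU => /(subsetP SU).
have setj S U : j \notin U -> S \subset U -> (j |: U) :\: S = j |: (U :\: S).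
  by move=> jU SU; rewrite setDUl (setDidPl _) // disjoints1 (nin _ U).
have setjj S U : j \notin U -> S \subset U -> (j |: U) :\: (j |: S) = U :\: S.
  move=> jU SU; rewrite setDUl; apply/setP => x; rewrite !inE.
  by have [->|] := eqVneq x j; rewrite ?(negbTE jU) ?andbF /=.
have dj S : j \notin S -> [disjoint [set j] & S] by rewrite disjoints1.
have njD S U : j \notin U -> j \notin U :\: S by move=> jU; rewrite inE negb_and jU orbT.
have [jV|jU] := boolP (j \in V).
  (* The left side vanishes as x^j occurs in x^V.  On the right, both terms
     contribute the product of the coefficients of f and g at sets that contain
     j, with opposite signs as #|S| and b have opposite parities. *)
  rewrite -(setD1K jV); set U := V :\ j; have jU : j \notin U by rewrite !inE eqxx.
  rewrite big_subset_setU1 // big1 // => S SU.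
  have jS := nin _ _ jU SU; have jUS := njD S _ jU.
  rewrite setj // setjj // !ffunE (negbTE jS) (negbTE jUS) !setU11.
  rewrite !(mul0r, mulr0, addr0, add0r).
  have [->|fS] := eqVneq (f (j |: S)) 0; first by rewrite !(mul0r, mulr0) addr0.
  have -> : b = ~~ odd #|S| by rewrite -(fb _ fS) cardsU1 jS.
  rewrite inversionsUr ?dj // inversionsUl ?dj // inversions1l !exprD.
  have E : (-1) ^+ #|S| = (-1) ^+ #|[set s in S | (s < j)%N]| *
      (-1) ^+ inversions S [set j] :> L by rewrite -exprD inversions1r.
  rewrite signrN signr_odd E.
  have E2 : (-1) ^+ #|[set s in U :\: S | (s < j)%N]| *
     (-1) ^+ #|[set s in U :\: S | (s < j)%N]| = 1 :> L by rewrite -expr2 sqrr_sign.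
  ring: E2.
rewrite big_subset_setU1 // mulr_sumr; apply: eq_bigr => S SU.
have jS := nin _ _ jU SU; have jUS := njD S _ jU.
rewrite setj // setjj // !ffunE (negbTE jS) (negbTE jUS).
have -> : #|[set s in V | (s < j)%N]| =
   (#|[set s in S | (s < j)%N]| + #|[set s in V :\: S | (s < j)%N]|)%N.
  rewrite -card_lt_disjoint; last first.
    by rewrite -setI_eq0; apply/eqP/setP => x; rewrite !inE; case: (x \in S).
  by congr #|pred_of_set _|; apply/setP => x; rewrite !inE;
     have := subsetP SU x; case: (x \in S) => //= ->.
rewrite inversionsUr ?dj // inversionsUl ?dj // inversions1l !exprD.
have E2 : (-1) ^+ #|[set s in V :\: S | (s < j)%N]| *
     (-1) ^+ #|[set s in V :\: S | (s < j)%N]| = 1 :> L by rewrite -expr2 sqrr_sign.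
rewrite [RHS]addrC mulrDr; congr (_ + _); last by ring: E2.
have [->|fS] := eqVneq (f S) 0; first by rewrite !(mul0r, mulr0).
have E : (-1) ^+ b = (-1) ^+ #|[set s in S | (s < j)%N]| *
      (-1) ^+ inversions S [set j] :> L.
  by rewrite -exprD inversions1r // -(fb _ fS) signr_odd.
rewrite E; ring.
Qed.

Lemma ederiv_setT j f : ederiv j f [set: 'I_n] = 0.
Proof. by rewrite ffunE inE. Qed.

End Exterior.

(** * Signs *)

Lemma odd_abszD (x y : int) : odd `|(x + y)%R|%N = odd `|x|%N (+) odd `|y|%N.
Proof. by lia. Qed.

Lemma exprz_sign (A : unitRingType) (x : int) :
  (-1 : A) ^ x = (-1) ^+ odd `|x|%N.
Proof.
rewrite signr_odd; case: x => // p.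
by rewrite NegzE -exprnN -exprVn invrN1 abszN.
Qed.

(** The Leibniz rule for d/dz on v (f g), with v of parity |d| + |z| and f of
    parity b, abstracted from the derivations: df, dg and dv stand for the
    derivatives.  Moving v past f yields b (|d| + |z|), moving d/dz past f
    yields b |z|, and the two leave the b |d| expected of xi. *)
Lemma graded_leibniz_sign (A : nzRingType) (db zb b : bool) (v dv f df g dg : A) :
  v * f = (-1) ^+ ((db (+) zb) && b) * (f * v) ->
  v * df * g + (-1) ^+ ((db (+) zb) && zb) * dv * f * g
    + (-1) ^+ (db && b) * (f * (v * dg)) =
  (-1) ^+ ((db (+) zb) && zb) *
    (dv * (f * g) + (-1) ^+ (zb && (db (+) zb)) *
       (v * (df * g + (-1) ^+ (zb && b) * (f * dg)))).
Proof.
rewrite !mulr_sign !mulrDr.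
rewrite (_ : v * (if zb && b then _ else _) =
   (-1) ^+ (zb && b) * (v * f * dg)); last first.
  by rewrite mulr_sign; case: (zb && b); rewrite ?mulrN mulrA.
move=> ->; rewrite !mulr_sign.
by case: zb; case: db; case: b => /=;
  rewrite ?(mulNr, opprD, opprK) !mulrA addrAC [RHS]addrC addrAC.
Qed.

(** * Partial derivatives and the formal integral *)

Section VectorFields.
Variables (k : fieldType) (m n : nat).
Variables (dy : 'I_m -> int) (dx : 'I_n -> int).
Hypothesis dy_even : forall i, ~~ odd `|dy i|%N.
Hypothesis dx_odd : forall j, odd `|dx j|%N.

Local Notation R := (Ralg k n dy).
Implicit Types (f g : R) (z : 'I_m + 'I_n) (t : k).

Lemma odd_ydeg (a : expo m) : ~~ odd `|ydeg dy a|%N.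
Proof.
apply: (big_ind (fun x : int => ~~ odd `|x|%N)) => // [x y|i _].
  by rewrite odd_abszD => /negPf-> /negPf->.
by rewrite abszM oddM (negPf (dy_even i)) andbF.
Qed.

Lemma odd_sum_dx (S : {set 'I_n}) : odd `|(\sum_(j in S) dx j)%R|%N = odd #|S|.
Proof.
rewrite -sum1_card.
apply: (big_ind2 (fun (x : int) (y : nat) => odd `|x|%N = odd y)) => // [x x' y y'|j _].
  by rewrite odd_abszD oddD => -> ->.
exact: dx_odd.
Qed.

(** The degree of y^a x^S is congruent to the size of S modulo 2. *)
Lemma homog_parity (p : int) f : homog dx p f -> has_parity (odd `|p|%N) f.
Proof.
move=> fp S fS.
have [a fSa] : exists a, f S a != 0.
  apply: contrapT => /forallNP h; move/eqP: fS; apply; apply: laurent_eq => a.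
  by have /negP := h a; rewrite negbK => /eqP.
by rewrite -(fp _ _ fSa) odd_abszD odd_sum_dx (negPf (odd_ydeg a)).
Qed.

Lemma partialM z b f g : has_parity b f ->
  partial z (f * g) =
  partial z f * g + (-1) ^+ (odd `|zdeg dy dx z|%N && b) * (f * partial z g).
Proof.
case: z => [i|j] fb /=; last by rewrite dx_odd (ederivM j g fb).
rewrite (negPf (dy_even i)) mul1r; apply/ffunP => S.
rewrite [RHS]ffunE ffunE !emulE -big_split /=.
have lderiv0 : lderiv i (0 : laurent k dy) = 0.
  by apply: laurent_eq => a; rewrite /= /lderiv_fun mulr0.
have lderivD h h' : lderiv i (h + h' : laurent k dy) = lderiv i h + lderiv i h'.
  by rewrite -[h]scale1r lderiv_linear !scale1r.
rewrite (big_morph (lderiv i) lderivD lderiv0); apply: eq_bigr => T _.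
have -> (e : nat) (h : laurent k dy) :
    lderiv i ((-1) ^+ e * h) = (-1) ^+ e * lderiv i h.
  rewrite -signr_odd !mulr_sign; case: odd => //.
  by apply: laurent_eq => a; rewrite laurentN /= /lderiv_fun laurentN mulrN.
by rewrite lderivM !ffunE mulrDr.
Qed.

Lemma integralD f g : integral (f + g) = integral f + integral g.
Proof. by rewrite /integral /berezin /residue ffunE. Qed.

Lemma integralZ t f : integral (t *: f) = t * integral f.
Proof. by rewrite /integral /berezin /residue ffunE. Qed.

Lemma integralN f : integral (- f) = - integral f.
Proof. by rewrite -scaleN1r integralZ mulN1r. Qed.

Lemma integral_sign (b : bool) f : integral ((-1) ^+ b * f) = (-1) ^+ b * integral f.
Proof. by rewrite !mulr_sign; case: b; rewrite ?integralN. Qed.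

Lemma integral_sum (I : Type) (r : seq I) (F : I -> R) :
  integral (\sum_(i <- r) F i) = \sum_(i <- r) integral (F i).
Proof.
apply: (big_morph _ integralD).
by rewrite -(scale0r (0 : R)) integralZ mul0r.
Qed.

(** Stokes: the divergence theorem without boundary, one direction at a time. *)
Lemma integral_partial z f : integral (partial z f) = 0.
Proof.
rewrite /integral /berezin; case: z => [i|j] /=; first by rewrite ffunE residue_lderiv.
by rewrite ederiv_setT.
Qed.

Lemma Ralg_scalerAr t f g : t *: (f * g) = f * (t *: g).
Proof.
apply/ffunP => S; rewrite [LHS]ffunE !emulE scaler_sumr; apply: eq_bigr => T _.
rewrite [in RHS]ffunE -laurent_scalerAr -signr_odd !mulr_sign.
by case: odd; rewrite ?scalerN.
Qed.

Lemma partial_linear z t f g : partial z (t *: f + g) = t *: partial z f + partial z g.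
Proof.
case: z => [i|j] /=; apply/ffunP => S; rewrite !ffunE.
  exact: lderiv_linear.
case: ifP => _; first by rewrite scaler0 addr0.
by rewrite -signr_odd !mulr_sign; case: odd; rewrite ?scalerN -?opprD.
Qed.

(** * Existence of the adjoint *)

Section Adjoint.
Variables (d : int) (xi : vfield k dy dx d).

Definition adjoint f : R := vapp xi f + divergence xi * f.

Fact adjoint_linear : linear adjoint.
Proof.
move=> t f g; rewrite /adjoint /vapp mulrDr -Ralg_scalerAr scalerDr scaler_sumr.
rewrite addrACA -big_split /=; congr (_ + _); apply: eq_bigr => z _.
by rewrite partial_linear mulrDr -Ralg_scalerAr.
Qed.

HB.instance Definition _ := GRing.isLinear.Build k R R _ adjoint adjoint_linear.

(** The Leibniz rules for v_z (f g) and f g, summed over z.  Every exchange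
    that costs a sign moves something past v_z or f, whose parities are known;
    g stays on the right throughout. *)
Lemma adjoint_total_derivative b f g : has_parity b f ->
  adjoint f * g + (-1) ^+ (odd `|d|%N && b) * (f * vapp xi g) =
  \sum_z (-1) ^+ (odd `|((d + zdeg dy dx z) * zdeg dy dx z)%R|%N) *
     partial z (vcoef xi z * (f * g)).
Proof.
move=> fb; rewrite /adjoint /vapp /divergence mulrDl !mulr_suml !mulr_sumr.
rewrite -!big_split /=; apply: eq_bigr => z _.
have vp := homog_parity (@vcoefP _ _ _ _ _ _ xi z).
rewrite (partialM z _ vp) (partialM z _ fb).
rewrite exprz_sign abszM oddM odd_abszD.
rewrite (_ : (-1) ^+ _ *: partial z (vcoef xi z) =
  (-1) ^+ ((odd `|d| (+) odd `|zdeg dy dx z|) && odd `|zdeg dy dx z|)%N *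
  partial z (vcoef xi z)); last by rewrite scaler_sign mulr_sign.
by apply: graded_leibniz_sign; rewrite -odd_abszD; exact: emulC_parity.
Qed.

Lemma adjointP : is_adjoint xi adjoint.
Proof.
move=> p f g fp; apply/eqP; rewrite -addr_eq0; apply/eqP.
rewrite exprz_sign abszM oddM -integral_sign -integralD.
rewrite (adjoint_total_derivative g (homog_parity fp)) integral_sum big1 // => z _.
by rewrite integral_sign integral_partial mulr0.
Qed.

End Adjoint.

(** * Uniqueness of the adjoint *)

Lemma pairingBl f f' g : pairing (f - f') g = pairing f g - pairing f' g.
Proof. by rewrite /pairing mulrBl integralD integralN. Qed.

Lemma pairing_nondegenerate f : (forall g, pairing f g = 0) -> f = 0.
Proof.
move=> f0; apply/ffunP => S; apply: laurent_eq => a; rewrite ffunE laurent0.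
(* The monomial dual to y^a x^S, up to sign. *)
pose g : R := [ffun T => if T == ~: S then lmono k dy ([ffun=> -1] - a) else 0].
have fgE : berezin (f * g) =
    (-1) ^+ inversions S (~: S) * (f S * lmono k dy ([ffun=> -1] - a)).
  rewrite /berezin emulE (bigD1 S) ?subsetT //= big1 ?addr0 => [|T /andP[_ /negPf TS]].
    by rewrite ffunE setTD eqxx.
  by rewrite ffunE setTD (inj_eq (inv_inj (@setCK _))) TS !mulr0.
have := f0 g; rewrite /pairing /integral fgE -signr_odd mulr_sign mulrC.
have lmE : (lmono k dy ([ffun=> -1] - a) * f S) [ffun=> -1] = f S a.
  by rewrite lmonoM opprB addrCA subrr addr0.
rewrite /residue; case: odd; rewrite ?laurentN lmE //.
by move/eqP; rewrite oppr_eq0 => /eqP.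
Qed.

Definition homog_part (p : int) f : R :=
  [ffun S : {set 'I_n} => ltrunc (fun e => e + \sum_(j in S) dx j == p) (f S)].

Lemma homog_partP p f : homog dx p (homog_part p f).
Proof. by move=> S a; rewrite ffunE /=; case: ifP => [/eqP|]; rewrite ?eqxx. Qed.

(** Each of the finitely many components f S involves finitely many degrees in
    the y^i, so only finitely many total degrees occur. *)
Lemma homog_decomposition f : exists r : seq int, f = \sum_(p <- r) homog_part p f.
Proof.
have /choice[s fs] : forall S : {set 'I_n}, exists s, degrees_in dy s (f S).
  by move=> S; apply: laurent_degrees.
pose r := flatten [seq [seq e + \sum_(j in U) dx j | e <- s U] | U : {set 'I_n}].
exists (undup r); apply/ffunP => S; apply: laurent_eq => a.
rewrite sum_ffunE laurent_sum; under eq_bigr do rewrite ffunE /=.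
have [fSa|fSa] := eqVneq (f S a) 0.
  by rewrite fSa big1 // => p _; case: ifP.
rewrite (bigD1_seq (ydeg dy a + \sum_(j in S) dx j)) ?undup_uniq //=.
  by rewrite eqxx big1 ?addr0 // => p /negPf; rewrite eq_sym => ->.
rewrite mem_undup; apply/flattenP.
exists [seq e + \sum_(j in S) dx j | e <- s S]; first exact: image_f.
by apply: map_f; apply: fs.
Qed.

End VectorFields.

Theorem proposition6p3 (k : fieldType) (char0 : [pchar k] =i pred0)
    (m n : nat) (dy : 'I_m -> int) (dx : 'I_n -> int)
    (dy_even : forall i, ~~ odd `|dy i|%N) (dx_odd : forall j, odd `|dx j|%N)
    (d : int) (xi : vfield k dy dx d) :
  (exists T : {linear Ralg k n dy -> Ralg k n dy}, is_adjoint xi T) /\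
  (forall T : {linear Ralg k n dy -> Ralg k n dy}, is_adjoint xi T ->
     forall f : Ralg k n dy, T f = vapp xi f + divergence xi * f).
Proof.
have adjP := adjointP dy_even dx_odd xi; split; first by eexists; exact: adjP.
move=> T TP f; rewrite -/(adjoint xi f).
have [r ->] := homog_decomposition dx f.
rewrite !linear_sum; apply: eq_bigr => p _; set h := homog_part _ _ _.
have hp : homog dx p h by apply: homog_partP.
apply/eqP; rewrite -subr_eq0; apply/eqP; apply: pairing_nondegenerate => g.
by rewrite pairingBl (TP p) // (adjP p) // subrr.
Qed.
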